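(* Let $1\le a\le 2$. (1) For all $0<x<y$, $$\frac{(\Gamma(x+a))^{1/x}}{(\Gamma(y+a))^{1/y}}<1.$$ (2) For all $x,y>0$, $$\frac{\left(\Gamma\left(\frac{x+y}{2}+a\right)\right)^{\frac{2}{x+y}}}{\sqrt{(\Gamma(x+a))^{1/x}(\Gamma(y+a))^{1/y}}}\ge 1,$$ with equality if and only if $x=y$.
   Context: $\Gamma$ is the gamma function on $(0,\infty)$. *)

(* Defs.v *)
From HB Require Import structures.
From mathcomp Require Import all_boot all_order all_algebra.
From mathcomp Require Import all_classical all_reals all_analysis.

Set Implicit Arguments.
Unset Strict Implicit.
Unset Printing Implicit Defensive.

Import Order.TTheory GRing.Theory Num.Theory.
Import numFieldNormedType.Exports.

Local Open Scope classical_set_scope.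
Local Open Scope ring_scope.

(* Euler's integral of the second kind. Only 0 < x is meaningful: for x <= 0
   the integral diverges and the real-valued [\int] takes the value 0. *)
Definition Gamma (R : realType) (x : R) : R :=
  \int[@lebesgue_measure R]_(t in `]0, +oo[) (t `^ (x - 1) * expR (- t)).

(* Main.v *)
Require Import Defs.
From HB Require Import structures.
From mathcomp Require Import all_boot all_order all_algebra.
From mathcomp Require Import all_classical all_reals all_analysis.
From mathcomp Require Import measurable_realfun ring lra.

Set Implicit Arguments.
Unset Strict Implicit.
Unset Printing Implicit Defensive.

Import Order.TTheory GRing.Theory Num.Theory.
Import numFieldNormedType.Exports.

Local Open Scope classical_set_scope.
Local Open Scope ring_scope.

(** Taking logarithms, both claims are about [f x = lnGamma (x + a) / x], where
    [lnGamma z = ln (Gamma z)], on the positive half-line: it is strictly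
    increasing and strictly midpoint-concave. [Gamma] itself is never
    differentiated, so the polygamma functions do not enter.

    Write [g = lnGamma] and split [f x = diffq g a x + g a / x], where
    [diffq g c x] is the difference quotient of [g] from [c] with step [x]. Since
    [Gamma 1 = Gamma 2 = 1] and [g] is convex, [g a <= 0] for [1 <= a <= 2], so
    the second summand is nondecreasing and concave. For the first one, the
    functional equation gives
      [diffq g c x = diffq g (c + 1) x - diffq ln c x].
    The function [diffq ln c], which is the mean of [1 / (c + s * x)] over [s]
    in the unit interval, is strictly decreasing and strictly midpoint-convex
    ([ln_diffq_decr], [ln_diffq_midpoint_lt]).

    Monotonicity follows at once, [diffq g (c + 1)] being nondecreasing by
    convexity of [g]. For concavity the functional equation is iterated: every
    step contributes a nonnegative amount to the midpoint gap, the first one a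
    positive amount, and the gap of the remainder [diffq g (c + n)] tends to 0,
    because convexity squeezes that quotient between [ln (c + n - 1)] and
    [ln (c + n + x)] ([midgap_diffq_tail]). This is the estimate behind the
    Bohr-Mollerup theorem and Gauss's product formula.

    What is used of [Gamma], only at arguments at least 1, is positivity, the
    functional equation [GammaS], [Gamma1] and log-convexity
    [Gamma_log_convex]; all of these are derived from Euler's integral. The
    argument on [g] is carried out for any function with these properties,
    [log_gamma_like]. *)

(** * Difference quotients of the logarithm *)

Definition diffq (R : realType) (g : R -> R) (c x : R) : R :=
  (g (c + x) - g c) / x.

Lemma is_derive_ln_scale (R : realType) (c x s : R) : 0 < c + s * x ->
  is_derive s 1 (fun s => ln (c + s * x)) (x / (c + s * x)).
Proof.
move=> h.
have H1 : is_derive s (1:R) (fun s : R => c + s * x) x.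
  by apply: is_derive_eq; rewrite !add0r mul1r scaler0 add0r [_ *: _]mulr1.
have H2 := is_derive1_ln h.
have := @is_derive1_comp R (@ln R) (fun s => c + s * x) s _ _ H2 H1.
by move=> H; apply: is_derive_eq H _; rewrite mulrC.
Qed.

(** Scaling the step by [s] moves from 0 at [s = 0] to [diffq ln c x] at
    [s = 1]. The derivative in [s] is [1 / (c + s * x)], a simple function of
    [x], so comparisons between the [diffq ln c x] for several [x] reduce to
    comparisons between reciprocals. *)
Lemma is_derive_ln_diffq (R : realType) (c x s : R) : 0 < c -> 0 < x -> 0 <= s ->
  is_derive s 1 (fun s => (ln (c + s * x) - ln c) / x) (c + s * x)^-1.
Proof.
move=> c0 x0 s0.
have h : 0 < c + s * x by rewrite ltr_pwDl// mulr_ge0// ltW.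
have H := is_derive_ln_scale h.
apply: is_derive_eq.
rewrite subr0 scaler0 add0r /GRing.scale/=.
field; apply/andP; split; lra.
Qed.

Lemma lt_of_derive_gt0 (R : realType) (G dG : R -> R) :
  (forall s : R, 0 <= s -> is_derive s 1 G (dG s)) ->
  (forall s : R, 0 < s -> 0 < dG s) -> G 0 < G 1.
Proof.
move=> HG dG0.
have [||c] := @MVT R G dG 0 1 ltr01.
- by move=> s; rewrite in_itv/= => /andP[s0 _]; apply: HG; exact: ltW.
- apply: derivable_within_continuous => s; rewrite in_itv/= => /andP[s0 _].
  by have := HG _ s0 => ?; exact: ex_derive.
- rewrite in_itv/= => /andP[c0 _]; rewrite subr0 mulr1 => E.
  by rewrite -subr_gt0 E dG0.
Qed.

(** Monotonicity of the reciprocal, integrated along the scaling path. *)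
Lemma ln_diffq_decr (R : realType) (c x y : R) : 0 < c -> 0 < x -> x < y ->
  diffq (@ln R) c y < diffq (@ln R) c x.
Proof.
move=> c0 x0 xy.
pose G s := (ln (c + s * x) - ln c) / x - (ln (c + s * y) - ln c) / y.
pose dG s := (c + s * x)^-1 - (c + s * y)^-1.
suff : G 0 < G 1.
  rewrite /G !mul0r addr0 !subrr !mul0r subrr !mul1r subr_gt0; exact.
apply: (@lt_of_derive_gt0 _ G dG) => s s0.
  have H1 := is_derive_ln_diffq c0 x0 s0.
  have H2 := is_derive_ln_diffq c0 (lt_trans x0 xy) s0.
  exact: is_deriveB.
rewrite /dG subr_gt0 ltf_pV2 ?posrE; nra.
Qed.

(** The gap is [(u - v) ^+ 2 / (2 * u * v * (u + v))]. *)
Lemma inv_midpoint_lt (R : realType) (u v : R) : 0 < u -> 0 < v -> u != v ->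
  ((u + v) / 2)^-1 < (u^-1 + v^-1) / 2.
Proof.
move=> u0 v0 uv.
have d : 0 < (u - v) ^+ 2 by rewrite exprn_even_gt0//= subr_eq0.
rewrite -subr_gt0.
have -> : (u^-1 + v^-1) / 2 - ((u + v) / 2)^-1 = (u - v) ^+ 2 / (2 * u * v * (u + v)).
  by field; rewrite !gt_eqF//= addr_gt0.
by rewrite divr_gt0// !mulr_gt0// addr_gt0.
Qed.

(** Strict convexity of the reciprocal, integrated along the scaling path. *)
Lemma ln_diffq_midpoint_lt (R : realType) (c x y : R) :
  0 < c -> 0 < x -> 0 < y -> x != y ->
  diffq (@ln R) c ((x + y) / 2) < (diffq (@ln R) c x + diffq (@ln R) c y) / 2.
Proof.
move=> c0 x0 y0 xy.
have m0 : 0 < (x + y) / 2 by lra.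
pose p z s := (ln (c + s * z) - ln c) / z : R.
pose G s := 2^-1 * (p x s + p y s) - p ((x + y) / 2) s.
pose dG s := 2^-1 * ((c + s * x)^-1 + (c + s * y)^-1) - (c + s * ((x + y) / 2))^-1.
suff : G 0 < G 1.
  rewrite /G /p !mul0r addr0 !subrr !mul0r addr0 mulr0 subrr !mul1r subr_gt0.
  by rewrite [X in _ < X -> _]mulrC.
apply: (@lt_of_derive_gt0 _ G dG) => s s0.
  have H1 := is_derive_ln_diffq c0 x0 s0.
  have H2 := is_derive_ln_diffq c0 y0 s0.
  have H3 := is_derive_ln_diffq c0 m0 s0.
  exact: (is_deriveB (is_deriveZ 2^-1 (is_deriveD H1 H2)) H3).
rewrite /dG subr_gt0.
have -> : c + s * ((x + y) / 2) = ((c + s * x) + (c + s * y)) / 2 by field.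
by rewrite [ltRHS]mulrC; apply: inv_midpoint_lt; nra.
Qed.

(** * Functions that behave like the logarithm of the gamma function *)

(** The hypotheses of the Bohr-Mollerup theorem, on the logarithm [g] of a gamma
    function and restricted to arguments at least 1. *)
Record log_gamma_like (R : realType) (g : R -> R) : Prop := {
  lgl_convex : forall u v l : R, 1 <= u -> 1 <= v -> 0 <= l <= 1 ->
    g (l * u + (1 - l) * v) <= l * g u + (1 - l) * g v ;
  lgl_succ : forall z : R, 1 <= z -> g (z + 1) = ln z + g z ;
  lgl_one : g 1 = 0 }.

(** Convexity with the denominators cleared: the form from which the slope
    comparisons below follow by arithmetic. *)
Lemma lgl_chord (R : realType) (g : R -> R) (p q r : R) : log_gamma_like g ->
  1 <= p -> p < q -> q < r -> g q * (r - p) <= g p * (r - q) + g r * (q - p).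
Proof.
move=> gl p1 pq qr.
have pr : 0 < r - p by lra.
have r1 : 1 <= r by lra.
have l01 : 0 <= (r - q) / (r - p) <= 1.
  by rewrite divr_ge0/= ?ler_pdivrMr ?mul1r//; lra.
have := lgl_convex gl p1 r1 l01.
have -> : (r - q) / (r - p) * p + (1 - (r - q) / (r - p)) * r = q.
  by field; lra.
rewrite -(ler_pM2r pr) => /le_trans; apply.
by rewrite le_eqVlt; apply/orP; left; apply/eqP; field; lra.
Qed.

(** [g] is convex and vanishes at 1 and, by the functional equation, at 2. *)
Lemma lgl_le0 (R : realType) (g : R -> R) (a : R) : log_gamma_like g ->
  1 <= a -> a <= 2 -> g a <= 0.
Proof.
move=> gl a1 a2.
have g1 := lgl_one gl.
have g2 : g 2 = 0 by rewrite (_ : 2 = 1 + 1)// (lgl_succ gl)// ln1 g1 addr0.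
move: a1; rewrite le_eqVlt => /predU1P[<-|a1]; first by rewrite g1.
move: a2; rewrite le_eqVlt => /predU1P[->|a2]; first by rewrite g2.
by have := lgl_chord gl (lexx 1) a1 a2; rewrite g1 g2; lra.
Qed.

Lemma diffq_lgl_succ (R : realType) (g : R -> R) (c x : R) : log_gamma_like g ->
  1 <= c -> 0 < x -> diffq g c x = diffq g (c + 1) x - diffq (@ln R) c x.
Proof.
move=> gl c1 x0; rewrite /diffq (addrAC c 1) !(lgl_succ gl)//; last lra.
by field; lra.
Qed.

Lemma diffq_lgl_nd (R : realType) (g : R -> R) (c x y : R) : log_gamma_like g ->
  1 <= c -> 0 < x -> x < y -> diffq g c x <= diffq g c y.
Proof.
move=> gl c1 x0 xy.
have := @lgl_chord R g c (c + x) (c + y) gl c1.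
rewrite ltrDl ltrD2l => /(_ x0 xy) H.
by rewrite /diffq ler_pdivrMr// mulrAC ler_pdivlMr; lra.
Qed.

(** The slope to the right of [c + 1] is at least the slope between [c] and
    [c + 1], which is [ln c] by the functional equation. *)
Lemma diffq_lgl_ge (R : realType) (g : R -> R) (c x : R) : log_gamma_like g ->
  1 <= c -> 0 < x -> ln c <= diffq g (c + 1) x.
Proof.
move=> gl c1 x0.
have := @lgl_chord R g c (c + 1) (c + 1 + x) gl c1.
rewrite !ltrDl => /(_ ltr01 x0).
by rewrite /diffq ler_pdivlMr// (lgl_succ gl)//; lra.
Qed.

(** The slope between [c] and [c + x] is at most the slope of the unit step
    after [c + x]. *)
Lemma diffq_lgl_le (R : realType) (g : R -> R) (c x : R) : log_gamma_like g ->
  1 <= c -> 0 < x -> diffq g c x <= ln (c + x).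
Proof.
move=> gl c1 x0.
have := @lgl_chord R g c (c + x) (c + x + 1) gl c1.
rewrite !ltrDl => /(_ x0 ltr01).
by rewrite /diffq ler_pdivrMr// (lgl_succ gl)//; lra.
Qed.

(** Convexity of [g] alone gives a weak inequality; strictness comes from the
    logarithmic term of the functional equation. *)
Lemma diffq_lgl_incr (R : realType) (g : R -> R) (c x y : R) :
  log_gamma_like g -> 1 <= c -> 0 < x -> x < y -> diffq g c x < diffq g c y.
Proof.
move=> gl c1 x0 xy; have y0 := lt_trans x0 xy.
rewrite (diffq_lgl_succ gl c1 x0) (diffq_lgl_succ gl c1 y0) ler_ltB//.
  by apply: diffq_lgl_nd => //; lra.
by apply: ln_diffq_decr => //; lra.
Qed.

(** * Midpoint concavity *)

Definition midgap (R : realType) (h : R -> R) (x y : R) : R :=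
  h ((x + y) / 2) - (h x + h y) / 2.

Lemma midgap_diffq_succ (R : realType) (g : R -> R) (c x y : R) :
  log_gamma_like g -> 1 <= c -> 0 < x -> 0 < y ->
  midgap (diffq g c) x y =
  midgap (diffq g (c + 1)) x y - midgap (diffq (@ln R) c) x y.
Proof.
move=> gl c1 x0 y0; have m0 : 0 < (x + y) / 2 by lra.
rewrite /midgap (diffq_lgl_succ gl c1 x0) (diffq_lgl_succ gl c1 y0).
by rewrite (diffq_lgl_succ gl c1 m0); field.
Qed.

Lemma midgap_diffq_ln_lt0 (R : realType) (c x y : R) :
  0 < c -> 0 < x -> 0 < y -> x != y -> midgap (diffq (@ln R) c) x y < 0.
Proof. by move=> c0 x0 y0 xy; rewrite /midgap subr_lt0 ln_diffq_midpoint_lt. Qed.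

(** Each use of the functional equation splits off a nonnegative gap, since
    [diffq ln (c + k)] is midpoint-convex. *)
Lemma midgap_diffq_shift (R : realType) (g : R -> R) (c x y : R) (n : nat) :
  log_gamma_like g -> 1 <= c -> 0 < x -> 0 < y -> x != y ->
  midgap (diffq g (c + n%:R)) x y <= midgap (diffq g c) x y.
Proof.
move=> gl c1 x0 y0 xy; elim: n => [|n IH]; first by rewrite addr0.
apply: le_trans IH.
have cn : 1 <= c + n%:R by have := ler0n R n; lra.
rewrite (midgap_diffq_succ gl cn)// -natr1 addrA lerDl oppr_ge0.
by apply/ltW/midgap_diffq_ln_lt0 => //; lra.
Qed.

(** All three quotients lie between [ln c] and [ln (c + 1 + x + y)], and these
    bounds differ by at most [(1 + x + y) / c], which vanishes as [c] grows. *)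
Lemma midgap_diffq_tail (R : realType) (g : R -> R) (c x y : R) :
  log_gamma_like g -> 1 <= c -> 0 < x -> 0 < y ->
  - ((1 + x + y) / c) <= midgap (diffq g (c + 1)) x y.
Proof.
move=> gl c1 x0 y0.
have m0 : 0 < (x + y) / 2 by lra.
have c11 : 1 <= c + 1 by lra.
have Hm := diffq_lgl_ge gl c1 m0.
have Hx := diffq_lgl_le gl c11 x0.
have Hy := diffq_lgl_le gl c11 y0.
have B z : 0 < z -> z <= x + y -> ln (c + 1 + z) <= ln c + (1 + x + y) / c.
  move=> z0 zxy.
  have -> : c + 1 + z = c * (1 + (1 + z) / c) by field; lra.
  have d0 : 0 <= (1 + z) / c by rewrite divr_ge0//; lra.
  rewrite lnM ?posrE; [|lra|lra].
  rewrite lerD2l; apply: le_trans (le_ln1Dx _) _; first lra.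
  by rewrite ler_pM2r ?invr_gt0; lra.
have Bx := B x x0; have By := B y y0.
by rewrite /midgap; lra.
Qed.

(** The first use of the functional equation yields the fixed positive amount
    [d]; after [n] further uses with [n] large, what is left cannot cancel
    [d]. *)
Lemma midgap_diffq_gt0 (R : realType) (g : R -> R) (c x y : R) :
  log_gamma_like g -> 1 <= c -> 0 < x -> 0 < y -> x != y ->
  0 < midgap (diffq g c) x y.
Proof.
move=> gl c1 x0 y0 xy.
have c0 : 0 < c by lra.
rewrite (midgap_diffq_succ gl c1 x0 y0).
have : 0 < - midgap (diffq (@ln R) c) x y.
  by rewrite oppr_gt0 midgap_diffq_ln_lt0.
move: (- midgap (diffq (@ln R) c) x y) => d d0.
(* With this [n] the error [(1 + x + y) / (c + n)] of the tail is below [d]. *)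
pose n := Num.bound ((1 + x + y) / d).
have nP : 1 + x + y < n%:R * d.
  by rewrite -ltr_pdivrMr// archi_boundP// divr_ge0//; lra.
have cn : 1 <= c + n%:R by have := ler0n R n; lra.
have tail := midgap_diffq_tail gl cn x0 y0.
have c2 : 1 <= c + 1 by lra.
have shift := midgap_diffq_shift n gl c2 x0 y0 xy.
rewrite addrAC in shift.
have err : (1 + x + y) / (c + n%:R) < d.
  by rewrite ltr_pdivrMr 1?mulrC 1?mulrDl ?ltr_wpDl ?mulr_ge0 ?ltW//; lra.
lra.
Qed.

Lemma lgl_ratioE (R : realType) (g : R -> R) (a x : R) :
  g (x + a) / x = diffq g a x + g a / x.
Proof. by rewrite /diffq addrC -mulrDl subrK addrC. Qed.

(** Strictness comes from [diffq g a]; the other summand [g a / x] is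
    nondecreasing in [x] because [g a <= 0]. *)
Lemma lgl_ratio_lt (R : realType) (g : R -> R) (a x y : R) : log_gamma_like g ->
  1 <= a -> a <= 2 -> 0 < x -> x < y -> g (x + a) / x < g (y + a) / y.
Proof.
move=> gl a1 a2 x0 xy; have y0 := lt_trans x0 xy.
rewrite !lgl_ratioE ltr_leD ?(diffq_lgl_incr gl)//.
by rewrite ler_wnM2l ?(lgl_le0 gl)// lef_pV2 ?posrE// ltW.
Qed.

(** Strictness comes from [diffq g a]; the other summand [g a / x] is
    midpoint-concave in [x] because [g a <= 0] and the reciprocal is convex. *)
Lemma midgap_lgl_ratio_gt0 (R : realType) (g : R -> R) (a x y : R) :
  log_gamma_like g -> 1 <= a -> a <= 2 ->
  0 < x -> 0 < y -> x != y -> 0 < midgap (fun x => g (x + a) / x) x y.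
Proof.
move=> gl a1 a2 x0 y0 xy; rewrite /midgap !lgl_ratioE.
have := midgap_diffq_gt0 gl a1 x0 y0 xy; rewrite /midgap.
have I := inv_midpoint_lt x0 y0 xy.
have : g a * ((x^-1 + y^-1) / 2) <= g a * ((x + y) / 2)^-1.
  by rewrite ler_wnM2l ?(lgl_le0 gl)// ltW.
lra.
Qed.

(** * Euler's integral for arguments at least 1 *)

Local Notation mu := (@lebesgue_measure _).

(** At [p = 0] continuity at the origin relies on the convention
    [0 `^ 0 = 1]. *)
Lemma powR_continuous_itv (R : realType) (p : R) : 0 <= p ->
  {within `[0, +oo[, continuous (fun t : R => t `^ p)}.
Proof.
rewrite le_eqVlt => /predU1P[<-|p0].
  rewrite (_ : (fun t : R => t `^ 0) = cst 1); last by apply/funext => t; rewrite powRr0.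
  by apply: continuous_subspaceT => x; exact: cst_continuous.
apply/continuous_within_itvcyP; split => [x|].
  rewrite in_itv/= andbT => x0.
  apply: differentiable_continuous; apply/derivable1_diffP.
  by apply: derivable_powR; rewrite in_itv/= andbT.
by rewrite powR0 ?gt_eqF//; exact: powR_cvg0.
Qed.

Lemma expRN_continuous (R : realType) (c : R) : continuous (fun t : R => expR (- (c * t))).
Proof.
move=> t; apply: continuous_comp; last exact: continuous_expR.
by apply: continuousN; apply: continuousM => //; exact: cst_continuous.
Qed.

Lemma expRN_cvg0 (R : realType) (c : R) : 0 < c ->
  expR (- (c * t)) @[t --> +oo] --> (0 : R).
Proof.
move=> c0; apply: (@cvg_comp _ _ _ (fun t => c * t) (fun t => expR (- t)) _ (pinfty_nbhs R)).
  exact: gt0_cvgMry.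
exact: cvgr_expR.
Qed.

Lemma is_derive_expRN (R : realType) (c t : R) :
  is_derive t 1 (fun t : R => expR (- (c * t))) (- c * expR (- (c * t))).
Proof.
have H1 : is_derive t (1:R) (fun t : R => - (c * t)) (- c).
  by apply: is_derive_eq; rewrite [_ *: _]mulr1.
have H2 := is_derive_expR (- (c * t)).
have H := @is_derive1_comp R (@expR R) (fun t => - (c * t)) t _ _ H2 H1.
by apply: is_derive_eq H _; rewrite mulrC.
Qed.

(** The constant [(2 * z) `^ z] comes from raising
    [t / (2 * z) <= expR (t / (2 * z))] to the power [z]. *)
Lemma powR_expR_bound (R : realType) (z : R) : 0 < z -> exists2 C : R, 0 < C &
  forall t, 0 <= t -> t `^ z * expR (- t) <= C * expR (- (2^-1 * t)).
Proof.
move=> z0; exists ((2 * z) `^ z); first by rewrite powR_gt0// mulr_gt0.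
move=> t t0.
have -> : expR (- t) = expR (- (2^-1 * t)) * expR (- (2^-1 * t)).
  by rewrite -expRD; congr expR; field.
rewrite mulrA ler_pM2r ?expR_gt0// -ler_pdivlMr ?expR_gt0// -expRN opprK.
have -> : expR (2^-1 * t) = (expR (t / (2 * z))) `^ z.
  by rewrite -expRM; congr expR; field; rewrite gt_eqF.
rewrite -powRM ?expR_ge0//; last lra.
apply: ge0_ler_powR; rewrite ?nnegrE//; try lra.
  by rewrite mulr_ge0 ?expR_ge0//; lra.
rewrite mulrC -ler_pdivrMr ?mulr_gt0//.
by apply: le_trans (expR_ge1Dx _); rewrite lerDr.
Qed.

Lemma integral_expRN (R : realType) (c : R) : 0 < c ->
  (\int[mu]_(t in `[0%R, +oo[) (expR (- (c * t)))%:E = c^-1%:E)%E.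
Proof.
move=> c0.
have dF (x : R) : is_derive x (1:R) (fun t : R => - c^-1 * expR (- (c * t)))
    (expR (- (c * x))).
  have H := is_derive_expRN c x.
  by apply: is_derive_eq; rewrite /GRing.scale/=; field; rewrite gt_eqF.
rewrite (@ge0_continuous_FTC2y _ _ (fun t => - c^-1 * expR (- (c * t))) _ 0).
- by rewrite mulr0 oppr0 expR0 mulr1 -EFinD opprK add0r.
- by move=> x _; rewrite expR_ge0.
- by apply: continuous_subspaceT; exact: expRN_continuous.
- rewrite -[X in _ --> X](mulr0 (- c^-1)).
  by apply: cvgMr; exact: expRN_cvg0.
- by move=> x _; have := dF x => ?; exact: ex_derive.
- by apply: cvgMr; apply: cvg_at_right_filter; exact: expRN_continuous.
- by move=> x _; rewrite derive1E; have := dF x => ?; exact: derive_val.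
Qed.

Lemma integrable_expRN (R : realType) (c : R) : 0 < c ->
  mu.-integrable `]0%R, +oo[ (EFin \o (fun t => expR (- (c * t)))).
Proof.
move=> c0; apply: (@integrableS _ _ _ mu `[0, +oo[) => //.
  by apply: subset_itvr; rewrite bnd_simp.
apply/integrableP; split.
  apply/measurable_EFinP; apply: measurable_funTS.
  by apply: continuous_measurable_fun; exact: expRN_continuous.
under eq_integral do rewrite /= ger0_norm ?expR_ge0//.
by rewrite integral_expRN// ltry.
Qed.

Lemma powR_expR_measurable (R : realType) (p : R) (D : set R) :
  measurable_fun D (fun t : R => t `^ p * expR (- t)).
Proof.
apply: measurable_funM.
  exact: (@measurableT_comp _ _ _ _ _ _ (@powR R ^~ p)).
by apply: measurableT_comp => //; exact: measurableT_comp.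
Qed.

Lemma Gamma_integrable (R : realType) (z : R) : 1 <= z ->
  mu.-integrable `]0%R, +oo[ (EFin \o (fun t => t `^ (z - 1) * expR (- t))).
Proof.
rewrite le_eqVlt => /predU1P[<-|z1].
  apply: eq_integrable (integrable_expRN ltr01) => // t _ /=.
  by rewrite subrr powRr0 !mul1r.
have [|C C0 HC] := @powR_expR_bound R (z - 1); first lra.
have H := @integrableZl _ _ _ mu `]0%R, +oo[ _ C _ (@integrable_expRN R 2^-1 _).
apply: le_integrable (H _ _) => //.
- by apply/measurable_EFinP; exact: powR_expR_measurable.
- move=> t; rewrite /= in_itv/= andbT => t0.
  rewrite lee_fin !ger0_norm ?mulr_ge0 ?powR_ge0 ?expR_ge0 ?(ltW C0)//.
  by apply: HC; exact: ltW.
Qed.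

(** On [1, 2] the integrand is at least [expR (- 2)]. *)
Lemma Gamma_gt0 (R : realType) (z : R) : 1 <= z -> 0 < Gamma z.
Proof.
move=> z1.
have I := Gamma_integrable z1.
have I12 : mu.-integrable `[1%R, 2%R] (EFin \o (fun t => t `^ (z - 1) * expR (- t))).
  apply: integrableS I => //= t /=; rewrite !in_itv/= andbT => /andP[t1 _]; lra.
apply: (@lt_le_trans _ _ (\int[mu]_(t in `[1%R, 2%R]) (t `^ (z - 1) * expR (- t)))).
  apply: (@lt_le_trans _ _ (\int[mu]_(t in `[1%R, 2%R]) (expR (- 2)))).
    rewrite Rintegral_cst//= lebesgue_measure_itv/= lte_fin ltr1n/=.
    by rewrite mulr_gt0 ?expR_gt0//; lra.
  apply: le_Rintegral => //.
    apply: continuous_compact_integrable; first exact: segment_compact.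
    by move=> x; exact: cst_continuous.
  move=> t; rewrite /= in_itv/= => /andP[t1 t2].
  rewrite -[leLHS]mul1r ler_pM ?expR_ge0//.
    by rewrite -[leLHS](powRr0 t) ler_powR//; lra.
  by rewrite ler_expR lerN2.
rewrite /Gamma /Rintegral fine_le//.
- exact: integrable_fin_num I12.
- exact: integrable_fin_num I.
apply: ge0_subset_integral => //.
- by apply/measurable_EFinP; exact: powR_expR_measurable.
- by move=> t _; rewrite lee_fin mulr_ge0 ?powR_ge0 ?expR_ge0.
- by move=> t /=; rewrite !in_itv/= andbT => /andP[t1 _]; lra.
Qed.

Lemma Gamma1 (R : realType) : Gamma (1 : R) = 1.
Proof.
rewrite /Gamma; under eq_Rintegral do rewrite subrr powRr0 mul1r -[X in expR (- X)]mul1r.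
rewrite Rintegral_itv_obnd_cbnd; last exact: integrable_expRN.
by rewrite /Rintegral integral_expRN// invr1.
Qed.

(** Integration by parts says that the derivative of [t `^ z * expR (- t)] has
    integral 0. That derivative changes sign, while the fundamental theorem of
    calculus on a half-line is applied to nonnegative integrands; adding
    [C * expR (- t / 2)], whose integral is known, makes it nonnegative when [C]
    is the constant of [powR_expR_bound]. *)
Lemma GammaS (R : realType) (z : R) : 1 <= z -> Gamma (z + 1) = z * Gamma z.
Proof.
move=> z1; have z0 : 0 < z by lra.
have [C C0 HC] := powR_expR_bound z0.
pose F (t : R) := t `^ z * expR (- (1 * t)) + (- (2 * C)) * expR (- (2^-1 * t)).
pose f (t : R) := z * (t `^ (z - 1) * expR (- (1 * t)))
   + (- (t `^ z * expR (- (1 * t))) + C * expR (- (2^-1 * t))).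
have dF (t : R) : 0 < t -> is_derive t (1:R) F (f t).
  move=> t0.
  have H1 := is_derive1_powR z t0.
  have H2 := is_derive_expRN 1 t.
  have H3 := is_derive_expRN 2^-1 t.
  have H := is_deriveD (is_deriveM H1 H2) (is_deriveZ (- (2 * C)) H3).
  suff -> : f t = t `^ z *: (- 1 * expR (- (1 * t)))
      + expR (- (1 * t)) *: (z * t `^ (z - 1))
      + - (2 * C) *: (- 2^-1 * expR (- (2^-1 * t))) by exact: H.
  by rewrite /f /GRing.scale/=; field.
have f0 (t : R) : 0 <= t -> 0 <= f t.
  move=> t0; rewrite /f addr_ge0//.
    by rewrite mul1r !mulr_ge0 ?powR_ge0 ?expR_ge0// ltW.
  by rewrite mul1r addrC subr_ge0 HC.
have cexp (c : R) : {within `[0, +oo[, continuous (fun t : R => expR (- (c * t)))}.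
  by apply: continuous_subspaceT; exact: expRN_continuous.
have cz : {within `[0, +oo[, continuous (fun t : R => t `^ z)}.
  by apply: powR_continuous_itv; exact: ltW.
have cf : {within `[0%R, +oo[, continuous f}.
  have cz1 : {within `[0, +oo[, continuous (fun t : R => t `^ (z - 1))}.
    by apply: powR_continuous_itv; lra.
  move=> t; apply: cvgD; [|apply: cvgD].
  - by apply: cvgMr; apply: cvgM; [exact: cz1|exact: cexp].
  - by apply: cvgN; apply: cvgM; [exact: cz|exact: cexp].
  - by apply: cvgMr; exact: cexp.
have Finf : F x @[x --> +oo%R] --> 0.
  rewrite -[X in _ --> X](addr0 0); apply: cvgD.
    apply: (@squeeze_cvgr _ _ _ _ (cst 0) (fun t => C * expR (- (2^-1 * t)))).
    - near=> t; rewrite mulr_ge0 ?powR_ge0 ?expR_ge0//= mul1r; apply: HC.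
      by near: t; exact: nbhs_pinfty_ge.
    - exact: cvg_cst.
    - rewrite -[X in _ --> X](mulr0 C).
      by apply: cvgMr; exact: expRN_cvg0.
  rewrite -[X in _ --> X](mulr0 (- (2 * C))).
  by apply: cvgMr; exact: expRN_cvg0.
have F0 : F x @[x --> 0^'+] --> F 0.
  apply: cvgD.
    apply: cvgM; first by have /continuous_within_itvcyP[] := cz.
    by apply: cvg_at_right_filter; exact: expRN_continuous.
  by apply: cvgMr; apply: cvg_at_right_filter; exact: expRN_continuous.
have dFex (t : R) : 0 < t -> derivable F t 1.
  by move=> /dF ?; exact: ex_derive.
have dFf : {in `]0, +oo[, F^`()%classic =1 f}.
  by move=> t; rewrite in_itv/= andbT derive1E => /dF ?; exact: derive_val.
have := @Rintegral_ge0_continuous_FTC2y _ f F 0 0 f0 cf Finf dFex F0 dFf.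
have Iz := Gamma_integrable z1.
have Iz1 : mu.-integrable `]0%R, +oo[ (EFin \o (fun t => t `^ z * expR (- t))).
  have /Gamma_integrable : 1 <= z + 1 by lra.
  by rewrite addrK.
have Ie : mu.-integrable `]0%R, +oo[ (EFin \o (fun t : R => expR (- (2^-1 * t)))).
  exact: integrable_expRN.
have fE : f = (fun t => z * (t `^ (z - 1) * expR (- t)) +
    (- (t `^ z * expR (- t)) + C * expR (- (2^-1 * t)))).
  by apply/funext => t; rewrite /f mul1r.
have I1 : mu.-integrable `]0%R, +oo[ (EFin \o (fun t => z * (t `^ (z - 1) * expR (- t)))).
  exact: integrableZl Iz.
have I2 : mu.-integrable `]0%R, +oo[ (EFin \o (fun t => - (t `^ z * expR (- t)))).
  exact: integrableN Iz1.
have I3 : mu.-integrable `]0%R, +oo[ (EFin \o (fun t => C * expR (- (2^-1 * t)))).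
  exact: integrableZl Ie.
have I23 : mu.-integrable `]0%R, +oo[
    (EFin \o (fun t => - (t `^ z * expR (- t)) + C * expR (- (2^-1 * t)))).
  exact: integrableD I2 I3.
have If : mu.-integrable `]0%R, +oo[ (EFin \o f).
  rewrite fE; exact: integrableD I1 I23.
rewrite -Rintegral_itv_obnd_cbnd// fE RintegralD// RintegralD// !RintegralZl//.
have -> : \int[mu]_(t in `]0%R, +oo[) (- (t `^ z * expR (- t))) = - Gamma (z + 1).
  rewrite /Gamma addrK -mulN1r -RintegralZl//.
  by apply: eq_Rintegral => t _; rewrite mulN1r.
have -> : \int[mu]_(t in `]0%R, +oo[) expR (- (2^-1 * t)) = 2 :> R.
  by rewrite Rintegral_itv_obnd_cbnd// /Rintegral integral_expRN//= invrK.
rewrite -/(Gamma z).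
rewrite /F powR0 ?gt_eqF// !mulr0 oppr0 expR0 mul0r.
by move: (Gamma (z + 1)) (z * Gamma z) => G1 zG; clear; lra.
Unshelve. all: by end_near. Qed.

(** Convexity of [expR] for exponents shifted by logarithms: with [p] and [q]
    the values of [Gamma] at two points, [expR x / p] and [expR y / q] are
    integrands normalized to have integral 1. *)
Lemma expR_convex_normalized (R : realType) (p q l x y : R) :
  0 < p -> 0 < q -> 0 <= l -> l <= 1 ->
  expR (l * x + (1 - l) * y) <=
    expR (l * ln p + (1 - l) * ln q) * l / p * expR x +
    expR (l * ln p + (1 - l) * ln q) * (1 - l) / q * expR y.
Proof.
move=> p0 q0 l0 l1.
have := @convex_expR R (Itv01 l0 l1) (x - ln p) (y - ln q).
rewrite !convRE /= !expRB !lnK ?posrE// => H.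
set K := l * ln p + _.
have -> : l * x + (1 - l) * y = K + (l * (x - ln p) + (1 - l) * (y - ln q)).
  by rewrite /K; ring.
rewrite expRD.
have -> : expR K * l / p * expR x + expR K * (1 - l) / q * expR y =
    expR K * (l * (expR x / p) + (1 - l) * (expR y / q)).
  by field; rewrite !gt_eqF.
by rewrite ler_pM2l ?expR_gt0.
Qed.

Lemma powR_expRE (R : realType) (t p : R) : 0 < t ->
  t `^ p * expR (- t) = expR (p * ln t - t).
Proof. by move=> t0; rewrite expRD /powR gt_eqF. Qed.

(** Hoelder's inequality in the form of its proof: integrate
    [expR_convex_normalized]. *)
Lemma Gamma_log_convex (R : realType) (u v l p q : R) :
  1 <= u -> 1 <= v -> 0 <= l <= 1 -> Gamma u = p -> Gamma v = q ->
  Gamma (l * u + (1 - l) * v) <= expR (l * ln p + (1 - l) * ln q).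
Proof.
move=> u1 v1 /andP[l0 l1] Gu Gv.
have p0 : 0 < p by rewrite -Gu Gamma_gt0.
have q0 : 0 < q by rewrite -Gv Gamma_gt0.
have w1 : 1 <= l * u + (1 - l) * v by nra.
set K := expR _.
pose a := K * l / p; pose b := K * (1 - l) / q.
have Iu : mu.-integrable `]0%R, +oo[
    (EFin \o (fun t => a * (t `^ (u - 1) * expR (- t)))).
  exact: integrableZl (Gamma_integrable u1).
have Iv : mu.-integrable `]0%R, +oo[
    (EFin \o (fun t => b * (t `^ (v - 1) * expR (- t)))).
  exact: integrableZl (Gamma_integrable v1).
have -> : K = \int[mu]_(t in `]0%R, +oo[)
    (a * (t `^ (u - 1) * expR (- t)) + b * (t `^ (v - 1) * expR (- t))).
  rewrite RintegralD// !RintegralZl// ?Gamma_integrable//.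
  move: Gu Gv; rewrite /Gamma => -> ->.
  by rewrite /a /b !divfK ?gt_eqF// -mulrDr subrKC mulr1.
apply: le_Rintegral => //.
- exact: Gamma_integrable.
- exact: integrableD Iu Iv.
move=> t; rewrite /= in_itv/= andbT => t0.
rewrite !powR_expRE//.
have -> : (l * u + (1 - l) * v - 1) * ln t - t =
    l * ((u - 1) * ln t - t) + (1 - l) * ((v - 1) * ln t - t) by ring.
exact: expR_convex_normalized.
Qed.

(** * Roots of the gamma function *)

(** An abstract [g], rather than [ln (Gamma z)] itself, so that the theorem below
    deals with exponentials of real numbers and no longer with integrals. *)
Lemma Gamma_log_gamma_like (R : realType) : exists2 g : R -> R,
  log_gamma_like g & forall z, 1 <= z -> Gamma z = expR (g z).
Proof.
exists (fun z => ln (Gamma z)); last by move=> z /Gamma_gt0 z0; rewrite lnK.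
split.
- move=> u v l u1 v1 l01; rewrite -ler_expR lnK; first exact: Gamma_log_convex.
  by rewrite posrE Gamma_gt0//; move: l01 => /andP[l0 l1]; nra.
- move=> z z1; rewrite GammaS// lnM// posrE ?Gamma_gt0//; lra.
- by rewrite Gamma1 ln1.
Qed.

Theorem corollary1 (R : realType) (a : R) (ha1 : 1 <= a) (ha2 : a <= 2) :
  (forall x y : R, 0 < x -> x < y ->
     Gamma (x + a) `^ (1 / x) / Gamma (y + a) `^ (1 / y) < 1) /\
  (forall x y : R, 0 < x -> 0 < y ->
     1 <= Gamma ((x + y) / 2 + a) `^ (2 / (x + y)) /
            Num.sqrt (Gamma (x + a) `^ (1 / x) * Gamma (y + a) `^ (1 / y)) /\
     (Gamma ((x + y) / 2 + a) `^ (2 / (x + y)) /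
        Num.sqrt (Gamma (x + a) `^ (1 / x) * Gamma (y + a) `^ (1 / y)) = 1
      <-> x = y)).
Proof.
have [g gl gE] := Gamma_log_gamma_like R.
have rootE x : 0 < x -> Gamma (x + a) `^ x^-1 = expR (g (x + a) / x).
  by move=> x0; rewrite gE -?expRM//; lra.
split=> x y x0 => [xy|y0].
  rewrite !div1r !rootE//; last exact: lt_trans xy.
  by rewrite -expRN -expRD expR_lt1 subr_lt0 (lgl_ratio_lt gl).
have m0 : 0 < (x + y) / 2 by lra.
have -> : Gamma ((x + y) / 2 + a) `^ (2 / (x + y)) /
    Num.sqrt (Gamma (x + a) `^ (1 / x) * Gamma (y + a) `^ (1 / y)) =
    expR (midgap (fun x => g (x + a) / x) x y).
  rewrite !div1r -[2 / (x + y)]invf_div !rootE// -expRD.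
  by rewrite -powR12_sqrt ?expR_ge0// -expRM -expRN -expRD.
have [<-|xy] := eqVneq x y.
  suff -> : midgap (fun x => g (x + a) / x) x x = 0 by rewrite expR0.
  have E : (x + x) / 2 = x by field.
  by rewrite /midgap E; field; rewrite gt_eqF.
have g0 := midgap_lgl_ratio_gt0 gl ha1 ha2 x0 y0 xy.
rewrite ltW ?expR_gt1//; split=> //; split=> [E|E].
  by move: g0; rewrite -expR_gt1 E ltxx.
by rewrite E eqxx in xy.
Qed.
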